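(* Let $k>1$, let $G=(V,E)$ be a $k$-representable graph and let $w$ be a $k$-representant of $G$, i.e. a $k$-uniform word over $V$ representing $G$. Then the Cartesian product $G\,\square\,K_2$, whose nodes are denoted $x_1,x_2$ for $x\in V$, is $(k+1)$-representable; more precisely, the concatenation $w'=f(w)\,g(w)$ is a $(k+1)$-uniform word representing $G\,\square\,K_2$, where $f,g$ are the occurrence-based functions defined, for $x\in V$ and $i\in\{1,\dots,k\}$, by $$f(x,i)=\begin{cases} x_1 & \text{if } i=1,\\ x_2x_1 & \text{if } 1<i\le k,\end{cases}\qquad g(x,i)=\begin{cases} x_2 & \text{if } i=1,\\ x_1x_2 & \text{if } i=2,\\ \epsilon & \text{if } 2<i\le k,\end{cases}$$ with $\epsilon$ the empty word.
   Context: Graphs are finite, simple and undirected. For a word $w$ over an alphabet $A$, two distinct letters $x,y\in A$ alternate in $w$ if deleting all letters other than $x,y$ from $w$ leaves a word of the form $xyxy\cdots$ or $yxyx\cdots$ (of even or odd length). A word $w$ over the alphabet $V$ represents (is a representant of) a graph $G=(V,E)$ if for all distinct $x,y\in V$: $(x,y)\in E$ if and only if $x$ and $y$ alternate in $w$. A word over $V$ is $k$-uniform if every letter of $V$ occurs exactly $k$ times in it. A graph is $k$-representable if some $k$-uniform word over its node set represents it; such a word is called a $k$-representant of the graph. Occurrence-based functions: given a map $h:V\times\{1,\dots,k\}\to (V')^*$ (words over an alphabet $V'$) and a word $w$ over $V$ in which every letter occurs at most $k$ times, $h(w)$ denotes the word over $V'$ obtained from $w$ by replacing, for each letter $x$ and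 each $i$, the $i$th occurrence (from the left) of $x$ in $w$ by the word $h(x,i)$. $K_2$ is the complete graph on two nodes. The Cartesian product $G\,\square\,H$ of $G=(V_G,E_G)$ and $H=(V_H,E_H)$ has node set $V_G\times V_H$, with $(x,z)$ and $(y,x')$ adjacent if and only if either $x=y$ and $(z,x')\in E_H$, or $z=x'$ and $(x,y)\in E_G$. The node $x_i$ of $G\,\square\,K_2$ is the pair $(x,i)$ with $i\in\{1,2\}$; thus $x_i,y_j$ are adjacent if and only if ($i=j$ and $(x,y)\in E$) or ($i\ne j$ and $x=y$). *)

(* Defs.v *)
From mathcomp Require Import all_boot.

Set Implicit Arguments.
Unset Strict Implicit.
Unset Printing Implicit Defensive.

Record sgraph := SGraph {
  vertex :> finType;
  adj : rel vertex;
  adj_sym : symmetric adj;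
  adj_irr : irreflexive adj
}.

Section Complete.
Variable n : nat.

Definition complete_adj : rel 'I_n := fun i j => i != j.

Fact complete_adj_sym : symmetric complete_adj.
Proof. by move=> i j; rewrite /complete_adj eq_sym. Qed.

Fact complete_adj_irr : irreflexive complete_adj.
Proof. by move=> i; rewrite /complete_adj eqxx. Qed.

Definition complete_graph := SGraph complete_adj_sym complete_adj_irr.
End Complete.

Definition K2 := complete_graph 2.

Section CartesianProduct.
Variables G H : sgraph.

Definition cart_adj : rel (G * H) := fun p q =>
  (p.1 == q.1) && adj p.2 q.2 || (p.2 == q.2) && adj p.1 q.1.

Fact cart_adj_sym : symmetric cart_adj.
Proof.
move=> p q; rewrite /cart_adj (eq_sym p.1) (eq_sym p.2).
by rewrite (adj_sym p.2) (adj_sym p.1).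
Qed.

Fact cart_adj_irr : irreflexive cart_adj.
Proof. by move=> p; rewrite /cart_adj !adj_irr !andbF. Qed.

Definition cart_prod := SGraph cart_adj_sym cart_adj_irr.
End CartesianProduct.

Section Words.
Variable A : eqType.

(* The word x y x y ... of length n. *)
Definition altword (x y : A) (n : nat) : seq A :=
  mkseq (fun i => if odd i then y else x) n.

Definition alternate (x y : A) (w : seq A) : Prop :=
  exists n, let r := [seq z <- w | (z == x) || (z == y)] in
    r = altword x y n \/ r = altword y x n.

Definition uniform_word (k : nat) (w : seq A) : Prop :=
  forall x : A, count_mem x w = k.
End Words.

Definition represents (G : sgraph) (w : seq G) : Prop :=
  forall x y : G, x != y -> (adj x y <-> alternate x y w).

Definition representant (k : nat) (G : sgraph) (w : seq G) : Prop :=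
  uniform_word k w /\ represents w.

Definition representable (k : nat) (G : sgraph) : Prop :=
  exists w : seq G, representant k w.

Section OccurrenceBased.
Variables (A : eqType) (B : Type) (h : A -> nat -> seq B).

(* [p] is the part of the word already read.  Occurrences are numbered from 1,
   so [h x 0] is never used, nor is [h x i] for [i] larger than the number of
   occurrences of [x]. *)
Fixpoint occ_map_after (p w : seq A) : seq B :=
  if w is x :: w' then
    h x (count_mem x p).+1 ++ occ_map_after (rcons p x) w'
  else [::].

Definition occ_map (w : seq A) : seq B := occ_map_after [::] w.
End OccurrenceBased.

Section PrismWord.
Variable G : sgraph.

(* The nodes 1 and 2 of [K2] are the elements 0 and 1 of ['I_2]. *)
Definition node1 (x : G) : cart_prod G K2 := (x, ord0).
Definition node2 (x : G) : cart_prod G K2 := (x, ord_max).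

Definition prism_f (x : G) (i : nat) : seq (cart_prod G K2) :=
  if i == 1 then [:: node1 x] else [:: node2 x; node1 x].

Definition prism_g (x : G) (i : nat) : seq (cart_prod G K2) :=
  if i == 1 then [:: node2 x]
  else if i == 2 then [:: node1 x; node2 x]
  else [::].

Definition prism_word (w : seq G) : seq (cart_prod G K2) :=
  occ_map prism_f w ++ occ_map prism_g w.
End PrismWord.

(* Main.v *)
Require Import Defs.
From mathcomp Require Import all_boot.
From mathcomp Require Import zify.

Set Implicit Arguments.
Unset Strict Implicit.
Unset Printing Implicit Defensive.

(** Write [w' = f(w) g(w)] for the prism word.  Everything is decided by looking
at two nodes of the prism at a time.

The two copies of one letter [x].  The part of [w'] above [x] depends only on
the number [k] of occurrences of [x], and it is [x1 (x2 x1)^(k-1) x2 x1 x2],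
that is [(x1 x2)^(k+1)] ([fiber_prism]).  Hence [w'] is [(k+1)]-uniform and
[x1], [x2] alternate in it.

Copies of distinct letters [x], [y].  A choice of one copy of each letter turns
[f] and [g] into rules that keep some occurrences of [w] and drop the others: a
letter at level 1 is kept by [f] always and by [g] at its second occurrence,
a letter at level 2 is kept by [f] from its second occurrence on and by [g] at
its first two.  So the part of [w'] on the two chosen copies is obtained from
the restriction [r] of [w] to [x] and [y] ([restrict_prism]), and alternation
just says that no two consecutive letters are equal ([alternateE]).
- Both at level 1 ([sorted_low]): [f] gives back [r], so [r] must alternate.
  If it does, [r = (ab)^k] by uniformity and [g] only appends [ab].
- Both at level 2 ([sorted_high]): if [r = (ab)^k], then [w'] gives
  [(ab)^(k-1) abab].  Conversely let [r = a b c s].  The word kept by [g] starts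
  with [a b], so [a <> b], and then with [c], as [c] occurs at most for the
  second time; so [b <> c].  The word kept by [f] is then [c s], whence all of
  [r] alternates.
- [x] at level 1 and [y] at level 2 ([not_sorted_mixed]): they are not adjacent,
  and they never alternate, as two equal consecutive letters appear in the part
  from [f] or in the part from [g], whatever the first three letters of [r]. *)

(** * Alternation as sortedness *)

Section Alternation.
Variable A : eqType.
Implicit Types (x y : A) (w s r : seq A).

Definition neq : rel A := fun a b => a != b.

Definition restrict x y w := [seq z <- w | (z == x) || (z == y)].

Lemma altwordS x y n : altword x y n.+1 = x :: altword y x n.
Proof.
rewrite /altword /mkseq /= (iotaDl 1 0) -map_comp; congr (_ :: _).
by apply: eq_map => i /=; case: (odd i).
Qed.

Lemma altword_path x y n : x != y -> path neq x (altword y x n).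
Proof.
elim: n x y => // n IHn x y xy.
by rewrite altwordS /= {1}/neq xy IHn // eq_sym.
Qed.

Lemma altword_sorted x y n : x != y -> sorted neq (altword x y n).
Proof. by case: n => // n xy; rewrite altwordS; apply: altword_path. Qed.

Lemma path_altword x y s :
    {subset s <= [:: x; y]} -> path neq x s ->
  x :: s = altword x y (size s).+1.
Proof.
elim: s x y => //= c s IHs x y sub /andP[xc cs]; rewrite altwordS.
have /orP[/eqP cx|/eqP cy]: (c == x) || (c == y).
- by have := sub c (mem_head _ _); rewrite !inE.
- by rewrite cx /neq eqxx in xc.
rewrite -cy -IHs // => z zs.
by have := sub z (mem_behead (s := c :: s) zs); rewrite !inE orbC cy.
Qed.

(** For two letters, a word without two equal consecutive letters is
determined by its first letter and its length. *)
Lemma alternateE x y w :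
  x != y -> alternate x y w <-> sorted neq (restrict x y w).
Proof.
move=> xy; split.
  by case=> n /= [] rE; rewrite /restrict rE altword_sorted // eq_sym.
have: {subset restrict x y w <= [:: x; y]}.
  by move=> z; rewrite mem_filter !inE => /andP[].
rewrite /alternate -/(restrict x y w); case: (restrict x y w) => [|a s] sub srt.
  by exists 0; left.
exists (size s).+1 => /=.
have := sub a (mem_head _ _); rewrite !inE.
case/orP=> /eqP ea; rewrite ea in sub srt *; [left|right];
  apply: path_altword => // z zs; have := sub z (mem_behead (s := _ :: s) zs);
  by rewrite // !inE orbC.
Qed.

Lemma alternate_sym x y w : alternate x y w <-> alternate y x w.
Proof.
by split=> -[n r]; exists n; rewrite /= (eq_filter (fun z => orbC _ _));
  case: r; tauto.
Qed.

Lemma restrict_count x y w :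
  (count_mem x (restrict x y w) = count_mem x w) *
  (count_mem y (restrict x y w) = count_mem y w).
Proof.
by split; rewrite count_filter; apply: eq_count => z /=;
  case: eqP => //= _; rewrite ?orbT.
Qed.

(** Alternation forces the two letters to have equally many occurrences, except
for one more of the first letter when it is also the last one. *)
Lemma count_path x y s : x != y ->
    {subset s <= [:: x; y]} -> path neq x s ->
  count_mem x (x :: s) = count_mem y (x :: s) + (last x s == x).
Proof.
elim: s x y => [|c s IHs] x y xy sub /=; first by rewrite eqxx (negPf xy).
case/andP=> xc cs.
have /orP[/eqP cx|/eqP cy]: (c == x) || (c == y).
- by have := sub c (mem_head _ _); rewrite !inE.
- by rewrite cx /neq eqxx in xc.
have sub' : {subset s <= [:: y; x]}.
  by move=> z zs; have := sub z (mem_behead (s := c :: s) zs); rewrite !inE orbC.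
have: last y s \in [:: x; y].
  by have := mem_last y s; rewrite !inE => /orP[->|/sub']; rewrite ?orbT // !inE orbC.
rewrite cy in cs *; have := IHs y x; rewrite eq_sym xy => /(_ isT sub' cs) /=.
rewrite !inE !eqxx (negPf xy) (eq_sym y x) (negPf xy).
case: (last y s =P y) => [->|_]; last by rewrite orbF => E ->; lia.
by rewrite eq_sym (negPf xy); lia.
Qed.

End Alternation.
Arguments neq {A}.

(** * Occurrence-based functions *)

Section OccMap.
Variable A : eqType.
Implicit Types (w p : seq A).

(** Erasing letters on both sides is compatible with an occurrence-based
function because the number of an occurrence of [z] depends on [z] alone.  The
prefixes [p] and [p'] need to agree on the surviving letters only; the guard
[0 < i] is there because occurrences are numbered from 1. *)
Lemma filter_occ_map_after (B : Type) (P : pred B) (Q : pred A)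
    (h h' : A -> nat -> seq B) p p' w :
    (forall z i, 0 < i -> filter P (h z i) = if Q z then h' z i else [::]) ->
    (forall z, Q z -> count_mem z p = count_mem z p') ->
  filter P (occ_map_after h p w) = occ_map_after h' p' (filter Q w).
Proof.
move=> hP; elim: w p p' => //= x w IHw p p' pp'.
rewrite filter_cat hP //; case Qx: (Q x) => /=.
  rewrite pp' //; congr (_ ++ _); apply: IHw => z Qz.
  by rewrite -!cats1 !count_cat pp'.
apply: IHw => z Qz; rewrite -cats1 count_cat /= -pp' //.
by case: eqP => [xz|_]; [rewrite xz Qz in Qx | rewrite !addn0].
Qed.

Lemma filter_occ_map (B : Type) (P : pred B) (Q : pred A)
    (h h' : A -> nat -> seq B) w :
    (forall z i, 0 < i -> filter P (h z i) = if Q z then h' z i else [::]) ->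
  filter P (occ_map h w) = occ_map h' (filter Q w).
Proof. by move=> hP; apply: filter_occ_map_after. Qed.

Lemma map_occ_map (B C : Type) (e : B -> C) (h : A -> nat -> seq B) w :
  map e (occ_map h w) = occ_map (fun z i => map e (h z i)) w.
Proof.
rewrite /occ_map; elim: w [::] => //= x w IHw p.
by rewrite map_cat IHw.
Qed.

(** Once every letter has been read often enough for [h] to be independent of
the occurrence number, the function is an ordinary substitution. *)
Lemma occ_map_after_stable (B : Type) (u : A -> seq B)
    (h : A -> nat -> seq B) p w :
    (forall z i, z \in w -> count_mem z p < i -> h z i = u z) ->
  occ_map_after h p w = flatten [seq u z | z <- w].
Proof.
elim: w p => //= x w IHw p hu.
rewrite hu ?mem_head //; congr (_ ++ _); apply: IHw => z i zw zi.
apply: hu; first exact: (mem_behead (s := x :: w) zw).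
by apply: leq_ltn_trans zi; rewrite -cats1 count_cat leq_addr.
Qed.

Definition occs (I : A -> pred nat) w :=
  occ_map (fun z i => nseq (I z i) z) w.

End OccMap.

(** * The alternation of two letters and of their copies *)

Section TwoLetters.
Variables (A : eqType) (x y : A).
Hypothesis xy : x != y.
Variables (r : seq A) (k : nat).
Hypotheses (k_gt1 : 1 < k) (r_sub : {subset r <= [:: x; y]}).
Hypotheses (r_x : count_mem x r = k) (r_y : count_mem y r = k).

(** The occurrences at which [prism_f] and [prism_g] emit the chosen copy of a
letter, when the letters in [U] are taken at level 2 and the others at level 1;
[restrict_prism] makes this precise. *)
Definition in_f (U : pred A) (z : A) (i : nat) := ~~ U z || (1 < i).
Definition in_g (U : pred A) (z : A) (i : nat) :=
  if U z then i <= 2 else i == 2.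

(** There are [2 * k >= 4] letters in [r]. *)
Lemma three_letters : exists a b c s, r = [:: a, b, c & s].
Proof.
move: r_x r_y k_gt1; case: r => [|a [|b [|c s]]] /=; last by exists a, b, c, s.
- by move=> <-.
- by move=> <-; case: (a == x).
- case: (a =P x) => [->|_]; first by rewrite (negPf xy); case: (b == y); lia.
  by case: (b == x); lia.
Qed.

(** Three letters of [r] are enough.  If [x] comes twice before the second [y],
then [in_f], which drops the first [y], leaves [x x] in front.  Otherwise [y]
comes twice before the second [x], and [in_g] leaves [y y] in front. *)
Lemma not_sorted_mixed (U : pred A) : ~~ U x -> U y ->
  ~~ sorted neq (occs (in_f U) r ++ occs (in_g U) r).
Proof.
move=> /negPf Ux Uy; apply/negP=> /cat_sorted2[].
have [a [b [c [s rE]]]] := three_letters.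
have yx : (y == x) = false by rewrite eq_sym (negPf xy).
move: r_sub; rewrite rE => sub.
have := sub a; have := sub b; have := sub c; rewrite !inE !eqxx !orbT.
case/(_ isT)/orP=> /eqP->; case/(_ isT)/orP=> /eqP->;
case/(_ isT)/orP=> /eqP->;
  by rewrite /occs /occ_map /in_f /in_g /= ?Ux ?Uy /= ?(negPf xy) ?yx ?eqxx /=
     /neq ?eqxx ?andbF.
Qed.

(** From here on the two letters are named [a], [b] in their order of
appearance, so that [x] and [y] need not be told apart. *)
Lemma first_two a b s : r = [:: a, b & s] -> a != b ->
  [/\ {subset r <= [:: a; b]}, count_mem a r = k & count_mem b r = k].
Proof.
move=> rE ab; have := @r_sub a; have := @r_sub b.
rewrite {1 2}rE !inE !eqxx !orbT => /(_ isT)/orP[]/eqP eb /(_ isT)/orP[]/eqP ea;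
  rewrite ea eb ?eqxx // in ab *.
by split=> // z /r_sub; rewrite !inE orbC.
Qed.

(** The shape [(ab)^k] with the first two occurrences of each letter split off:
these are the only ones that [in_f] and [in_g] treat in a special way. *)
Lemma sorted_form : sorted neq r ->
  exists a b s, [/\ r = [:: a, b, a, b & s], last b s = b, a != b
    & {subset s <= [:: a; b]}].
Proof.
move=> srt; have [a [b [c [s rE]]]] := three_letters.
rewrite rE /= in srt; case/and3P: srt; rewrite /neq => ab bc cs.
have [sub ra rb] := first_two rE ab.
have ca : c = a.
  have := sub c; rewrite rE !inE eqxx !orbT => /(_ isT)/orP[]/eqP // cb.
  by rewrite cb eqxx in bc.
rewrite {c bc}ca in rE cs.
case: s rE cs => [|d s] rE /= => [_|/andP[ad ds]].
  by move: rb; rewrite rE /= eqxx (negPf ab); lia.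
have db : d = b.
  have := sub d; rewrite rE !inE eqxx !orbT => /(_ isT)/orP[]/eqP // da.
  by rewrite da /neq eqxx in ad.
rewrite {d ad}db in rE ds.
have subs : {subset [:: b, a, b & s] <= [:: a; b]}.
  by move=> z zs; apply: sub; rewrite rE inE zs orbT.
exists a, b, s; split=> //; last by move=> z zs; rewrite subs // !inE zs !orbT.
have pth : path neq a [:: b, a, b & s] by rewrite /= /neq ab eq_sym ab.
have := count_path ab subs pth; rewrite -rE ra rb /=.
have := mem_last b s; rewrite inE => /orP[/eqP//|ls].
have := subs (last b s); rewrite !inE ls !orbT => /(_ isT)/orP[]/eqP // ->.
by rewrite eqxx; lia.
Qed.

Lemma sorted_low :
  sorted neq (occs (in_f pred0) r ++ occs (in_g pred0) r) = sorted neq r.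
Proof.
have -> : occs (in_f pred0) r = r.
  rewrite /occs /occ_map (occ_map_after_stable (u := fun z => [:: z])) //.
  by rewrite flatten_map1 map_id.
apply/idP/idP => [/cat_sorted2[]//|srt].
have [a [b [s [rE lst ab sub]]]] := sorted_form srt.
have ba : (b == a) = false by rewrite eq_sym (negPf ab).
have -> : occs (in_g pred0) r = [:: a; b].
  rewrite rE /occs /occ_map /= /in_g /= !eqxx ba (negPf ab) /=.
  rewrite (occ_map_after_stable (u := fun=> [::])).
    by elim: s {rE lst sub}.
  move=> z i /sub; rewrite !inE /=.
  by case/orP=> /eqP->; rewrite ?eqxx ?ba ?(negPf ab); case: i => [|[|[|i]]].
move: srt; rewrite rE /= cat_path lst /= => /and4P[_ _ _ ->] /=.
by rewrite /neq ba ab.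
Qed.

Lemma occs_in_f_high a b s : r = [:: a, b & s] -> a != b ->
  occs (in_f predT) r = s.
Proof.
move=> rE ab; have [sub _ _] := first_two rE ab.
rewrite rE /occs /occ_map /= (negPf ab) /=.
rewrite (occ_map_after_stable (u := fun z => [:: z])).
  by rewrite flatten_map1 map_id.
move=> z i zs; have := sub z; rewrite rE !inE zs !orbT /in_f /=.
by case/(_ isT)/orP=> /eqP->; rewrite ?eqxx; case: i => [|[|i]] //; lia.
Qed.

Lemma sorted_high :
  sorted neq (occs (in_f predT) r ++ occs (in_g predT) r) = sorted neq r.
Proof.
apply/idP/idP => [|srt].
  case/cat_sorted2; have [a [b [c [s rE]]]] := three_letters.
  (* [in_g] keeps the first three letters of [r], unless they are all equal. *)
  have [t [gE tE]] : exists t, occs (in_g predT) r = [:: a, b & t] /\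
      (a != b -> exists t', t = c :: t').
    rewrite rE /occs /occ_map /= /in_g /=; eexists; split.
      by have -> : (a == b) + 0 < 2 by case: (a == b).
    move=> ab; have -> : (a == c) + ((b == c) + 0) < 2.
      case: (a =P c) => [<-|_]; last by case: (b == c).
      by rewrite eq_sym (negPf ab).
    by eexists.
  rewrite gE => srtf /= /andP[ab]; have [t' ->] := tE ab => /= /andP[bc _].
  by rewrite (occs_in_f_high rE ab) in srtf; rewrite rE /= ab bc.
have [a [b [s [rE lst ab sub]]]] := sorted_form srt.
have ba : (b == a) = false by rewrite eq_sym (negPf ab).
have -> : occs (in_g predT) r = [:: a; b; a; b].
  rewrite rE /occs /occ_map /= /in_g /= !eqxx ba (negPf ab) /=.
  rewrite (occ_map_after_stable (u := fun=> [::])).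
    by elim: s {rE lst sub}.
  move=> z i /sub; rewrite !inE /=.
  by case/orP=> /eqP->; rewrite ?eqxx ?ba ?(negPf ab); case: i => [|[|[|i]]].
rewrite (occs_in_f_high rE ab).
move: srt; rewrite rE /= cat_path lst /= => /and4P[_ _ _ ->] /=.
by rewrite /neq ba ab.
Qed.

End TwoLetters.

(** * The word of the prism *)

Lemma flatten_nseq_rot (A : Type) (a b : A) n :
  a :: flatten (nseq n [:: b; a]) ++ [:: b; a; b] =
  flatten (nseq n.+2 [:: a; b]).
Proof. by elim: n => //= n ->. Qed.

Section Prism.
Variables (G : sgraph) (k : nat) (w : seq G).
Hypotheses (k_gt1 : 1 < k) (w_k : uniform_word k w).
Local Notation node := (cart_prod G K2).
Implicit Types (x y z : G) (U : pred G) (p q : node).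

Definition copy U z : node := if U z then node2 z else node1 z.

Lemma copy_inj U : injective (copy U).
Proof. by move=> x y; rewrite /copy; do 2 case: ifP => _; case. Qed.

Lemma copy_fst U z : (copy U z).1 = z.
Proof. by rewrite /copy; case: ifP. Qed.

Lemma nodeP p : p = node1 p.1 \/ p = node2 p.1.
Proof.
by case: p => x [[|[|]] // lt_i2]; [left|right]; congr (_, _); apply: val_inj.
Qed.

Lemma node_eqE :
  ((forall x y, (node1 x == node1 y) = (x == y)) *
   (forall x y, (node2 x == node2 y) = (x == y)) *
   (forall x y, (node1 x == node2 y) = false) *
   (forall x y, (node2 x == node1 y) = false))%type.
Proof. by do !split; move=> x y; rewrite xpair_eqE ?andbT ?andbF. Qed.

Lemma cart_adjE :
  ((forall x y, adj (node1 x) (node1 y) = adj x y) *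
   (forall x y, adj (node2 x) (node2 y) = adj x y) *
   (forall x y, adj (node1 x) (node2 y) = (x == y)))%type.
Proof.
by do !split; move=> x y; rewrite /= /cart_adj /= /complete_adj ?andbF ?andbT ?orbF.
Qed.

(** Reduces the alternation of the chosen copies of [x] and [y] to a question
about the restriction of [w]. *)
Lemma restrict_prism x y U :
  restrict (copy U x) (copy U y) (prism_word w) =
  map (copy U) (occs (in_f U) (restrict x y w) ++ occs (in_g U) (restrict x y w)).
Proof.
rewrite /restrict; set Q : pred G := fun z => (z == x) || (z == y).
have copyE p z : (p == copy U z) = (p == copy U p.1) && (p.1 == z).
  apply/eqP/andP => [->|[/eqP-> /eqP<-]]; last by rewrite copy_fst.
  by rewrite copy_fst !eqxx.
rewrite (eq_filter (a2 := fun p => (p == copy U p.1) && Q p.1)); last first.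
  by move=> p; rewrite /= (copyE p x) (copyE p y) -andb_orr.
rewrite filter_cat map_cat /occs !map_occ_map.
by congr (_ ++ _); apply: filter_occ_map => z [|[|[|i]]] // _;
  rewrite /prism_f /prism_g /in_f /in_g /= /copy; case: (Q z); case Uz: (U z);
  rewrite ?node_eqE ?eqxx /= ?Uz.
Qed.

(** Counting the letters of the right-hand side gives uniformity, and its form
gives the edges between the two levels. *)
Lemma fiber_prism x :
  [seq p <- prism_word w | p.1 == x] =
  flatten (nseq k.+1 [:: node1 x; node2 x]).
Proof.
have wx : [seq z <- w | z == x] = nseq k x.
  rewrite -(w_k x) -size_filter; apply/all_pred1P.
  by apply/allP=> z; rewrite mem_filter => /andP[].
rewrite filter_cat.
rewrite (filter_occ_map (Q := pred1 x) (h' := prism_f (G := G))); last first.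
  by move=> z i _; rewrite /prism_f /=; case: (i == 1); rewrite /=; case: (z == x).
rewrite (filter_occ_map (Q := pred1 x) (h' := prism_g (G := G))); last first.
  move=> z i _; rewrite /prism_g /=.
  by case: (i == 1); case: (i == 2); rewrite /=; case: (z == x).
rewrite wx; case: k k_gt1 => [|[|n]] // _.
rewrite /occ_map /= eqxx.
rewrite (occ_map_after_stable (u := fun z => [:: node2 z; node1 z])); last first.
  by move=> z [|[|i]] //; rewrite mem_nseq => /andP[_ /eqP->]; rewrite /= eqxx.
rewrite (occ_map_after_stable (u := fun z => [::])); last first.
  by move=> z [|[|[|i]]] //; rewrite mem_nseq => /andP[_ /eqP->]; rewrite /= eqxx.
have gE : flatten [seq [::] | _ <- nseq n x] = [::] :> seq node by elim: n.
by rewrite gE map_nseq; apply: (flatten_nseq_rot _ _ n.+1).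
Qed.

Lemma alternate_copy x y U : x != y ->
  let r := restrict x y w in
  alternate (copy U x) (copy U y) (prism_word w) <->
  sorted neq (occs (in_f U) r ++ occs (in_g U) r).
Proof.
move=> xy r; have e_inj := @copy_inj U.
have : copy U x != copy U y by rewrite (inj_eq e_inj).
move/alternateE=> /(_ (prism_word w)); rewrite restrict_prism sorted_map.
by under eq_sorted => a b do rewrite /= /neq (inj_eq e_inj) -/(neq a b).
Qed.

(** A node occurs only in the fiber above its first component, and once in each
factor of that fiber. *)
Lemma prism_uniform : uniform_word k.+1 (prism_word w).
Proof.
move=> p.
have := congr1 (count_mem p) (fiber_prism p.1).
rewrite count_filter => e; rewrite -[RHS]muln1.
have <- : count_mem p [:: node1 p.1; node2 p.1] = 1.
  by case: (nodeP p) => {1 2}->; rewrite /= !node_eqE eqxx.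
have -> : count_mem p (prism_word w) =
  count (predI (pred1 p) (fun q => q.1 == p.1)) (prism_word w).
  by apply: eq_count => q /=; case: eqP => // ->; rewrite eqxx.
by rewrite e count_flatten map_nseq sumn_nseq mulnC.
Qed.

Hypothesis w_G : represents w.

Lemma restrict_uniform x y :
  [/\ {subset restrict x y w <= [:: x; y]}, count_mem x (restrict x y w) = k
    & count_mem y (restrict x y w) = k].
Proof.
rewrite !restrict_count; split; [|exact: w_k|exact: w_k].
by move=> z; rewrite mem_filter !inE => /andP[].
Qed.

Lemma alternate_fiber x : alternate (node1 x) (node2 x) (prism_word w).
Proof.
have n12 : node1 x != node2 x by rewrite node_eqE.
apply/(alternateE _ n12); rewrite /restrict.
rewrite (eq_filter (a2 := fun p => p.1 == x)); last first.
  by move=> p; case: (nodeP p) => ->; rewrite !node_eqE ?orbF.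
rewrite fiber_prism /= /neq node_eqE /=.
by elim: k => //= n IHn; rewrite /neq !node_eqE.
Qed.

Lemma not_alternate_mixed x y :
  x != y -> ~ alternate (node1 x) (node2 y) (prism_word w).
Proof.
move=> xy; have [sub cx cy] := restrict_uniform x y.
have := alternate_copy (pred1 y) xy.
rewrite /copy /= (negPf xy) eqxx => -> srt.
have Uy : pred1 y y by rewrite /= eqxx.
by have /negP := not_sorted_mixed xy k_gt1 sub cx cy (U := pred1 y) xy Uy.
Qed.

Lemma prism_represents : represents (prism_word w).
Proof.
have mixed x y : adj (node1 x) (node2 y) <->
                 alternate (node1 x) (node2 y) (prism_word w).
  rewrite cart_adjE; case: eqVneq => [<-|xy].
    by split=> // _; apply: alternate_fiber.
  by split=> // /(not_alternate_mixed xy).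
move=> p q; case: (nodeP p) => ->; case: (nodeP q) => ->.
- set x := p.1; set y := q.1; rewrite node_eqE cart_adjE => xy.
  have [sub cx cy] := restrict_uniform x y.
  rewrite (alternate_copy pred0 xy) (sorted_low xy k_gt1 sub cx cy).
  by rewrite -(alternateE _ xy); apply: w_G.
- by move=> _; apply: mixed.
- by move=> _; rewrite adj_sym alternate_sym; apply: mixed.
- set x := p.1; set y := q.1; rewrite node_eqE cart_adjE => xy.
  have [sub cx cy] := restrict_uniform x y.
  rewrite (alternate_copy predT xy) (sorted_high xy k_gt1 sub cx cy).
  by rewrite -(alternateE _ xy); apply: w_G.
Qed.

End Prism.

Theorem theorem7 (k : nat) (G : sgraph) (w : seq G) :
  1 < k ->
  representant k w ->
  representable k.+1 (cart_prod G K2) /\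
  representant k.+1 (prism_word w).
Proof.
move=> k_gt1 [w_k w_G].
have prism_rep : representant k.+1 (prism_word w).
  by split; [apply: prism_uniform | apply: prism_represents k_gt1 w_k w_G].
by split=> //; exists (prism_word w).
Qed.
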